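(* There is a canonical bijection between sequences $(\pi_n\mid n\ge1)$, where each $\pi_n$ is an admissible permutation of $\{0,\ldots,2^{n(M+1)}-1\}$, and trim, strong triangular array representations $(R^*_{n,i}\mid n\ge 1,\ 1\le i\le n)$ of the sequence $\{S^*_n\}$. It sends $(\pi_n)$ to the array defined by: for $n\ge1$, $x\in D_{n,\ell}$ with $0\le\ell<2^{n(M+1)}$, and $1\le i\le n$, $R^*_{n,i}(x):=R_i(y)$ for any $y\in E_{n,\pi_n(\ell)}$.
   Context: Work in the probability space $(0,1)$ with Lebesgue measure. For $x\in(0,1)$ write $x=\sum_{i\ge1}\varepsilon_i(x)2^{-i}$ with $\varepsilon_i(x)\in\{0,1\}$ and $\varepsilon_i(x)=0$ for infinitely many $i$. Fix an integer $M\ge 0$, put $m=2^{M+1}$, and fix a random variable $O:(0,1)\to\mathbb{R}$ such that $O(x)$ depends bijectively on $(\varepsilon_1(x),\ldots,\varepsilon_{M+1}(x))$. Its $m$ distinct outcomes are enumerated increasingly as $o_1<\cdots<o_m$; they are equally likely, $\sum_s o_s=0$, and $O$ has variance $1$, i.e. $\sum_s o_s^2=m$. Let $\varsigma_s\in\{0,1\}^{M+1}$ be such that $O(x)=o_s$ iff $(\varepsilon_1(x),\ldots,\varepsilon_{M+1}(x))=\varsigma_s$. Arrange the positive integers consecutively, in increasing order, in rows indexed by $\rho=1,2,\ldots$, where row $\rho$ has length $b$, the unique positive integer with $(b-1)(M+1)<\rho\le b(M+1)$. Let $J_i$ be the $i$-th column (the set of $i$-th entries of all rows of length $\ge i$),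 enumerated increasingly as $j_{i,1}<j_{i,2}<\cdots$; let $\overline J_i=\{j_{i,1},\ldots,j_{i,M+1}\}$ and $\overline J^n=\overline J_1\cup\cdots\cup\overline J_n$. Let $P_i(x)$ be the number with $\varepsilon_k(P_i(x))=\varepsilon_{j_{i,k}}(x)$ for all $k$, and $R_i(x)=O(P_i(x))$; that is, for every $x\in(0,1)$, $R_i(x)=o_s$ iff $(\varepsilon_{j_{i,1}}(x),\ldots,\varepsilon_{j_{i,M+1}}(x))=\varsigma_s$. Put $S_n=\sum_{i=1}^n R_i$. The quantile $S^*_n$ of $S_n$ is $S^*_n(x)=\inf\{t\in\mathbb{R}\mid C(t)>x\}$ for $x\in(0,1)$, where $C$ is the cumulative distribution function of $S_n$. A random variable $Y$ on $(0,1)$ is $n$-trim iff $Y(y)$ depends only on $(\varepsilon_1(y),\ldots,\varepsilon_{n(M+1)}(y))$. For $0\le\ell<2^{n(M+1)}$: $D_{n,0}=(0,2^{-n(M+1)})$ and $D_{n,\ell}=[\ell 2^{-n(M+1)},(\ell+1)2^{-n(M+1)})$ for $\ell>0$. Let $(\vec e_\ell\mid 0\le\ell<2^{n(M+1)})$ be the lexicographically increasing enumeration of $\{0,1\}^{\overline J^n}$ (coordinates $\overline J^n$ taken in increasing order), and $E_{n,\ell}=\{x\in(0,1)\mid \varepsilon_j(x)=(\vec e_\ell)_j\text{ for all }j\in\overline J^n\}$. Each $R_i$ ($1\le i\le n$), and hence $S_n$, is constant on each $E_{n,\ell}$. A permutation $\pi$ of $\{0,\ldots,2^{n(M+1)}-1\}$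 is admissible iff for all $0\le\ell<2^{n(M+1)}$: $S^*_n(x)=S_n(y)$ for all $x\in D_{n,\ell}$ and all $y\in E_{n,\pi(\ell)}$. A trim, strong triangular array representation of $\{S^*_n\}$ is an array $(R^*_{n,i}\mid n\ge1,\ 1\le i\le n)$ of random variables on $(0,1)$ such that for each $n$, the row $(R^*_{n,i}\mid 1\le i\le n)$ is an i.i.d. family of $n$-trim random variables, each with mean $0$, variance $1$ and with the outcomes $o_1,\ldots,o_m$ of $O$ as values with equal probability, and $S^*_n=\sum_{i=1}^nR^*_{n,i}$ pointwise as functions on $(0,1)$. *)

(* Defs.v *)
From HB Require Import structures.
From mathcomp Require Import all_boot all_order perm all_algebra.
From mathcomp Require Import all_classical all_reals all_analysis.
From mathcomp Require Import measurable_realfun.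
From mathcomp Require Import lra zify.

Set Implicit Arguments.
Unset Strict Implicit.
Unset Printing Implicit Defensive.

Import Order.TTheory GRing.Theory Num.Theory.
Import numFieldNormedType.Exports.
Import Order.TupleLexiOrder.Exports.

Local Open Scope classical_set_scope.
Local Open Scope ring_scope.

Definition oitv01 (R : realType) : Type := {x : R | 0 < x < 1}.

HB.instance Definition _ (R : realType) := Choice.on (oitv01 R).

Lemma half_in01 (R : realType) : 0 < (2^-1 : R) < 1.
Proof. by rewrite invr_gt0 ltr0n /= invf_lt1 ?ltr0n// ltr1n. Qed.

HB.instance Definition _ (R : realType) := isPointed.Build (oitv01 R)
  (exist (fun x : R => is_true (0 < x < 1)) 2^-1 (half_in01 R)).

Definition val01 (R : realType) (x : oitv01 R) : R := val x.

(* The trace on (0,1) of the Borel sigma-algebra of the real line. *)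
Definition I01 (R : realType) : Type := g_sigma_algebra_preimageType (@val01 R).

Coercion real_of_I01 (R : realType) (x : I01 R) : R := @val01 R x.

Section lebesgue01.
Context {R : realType}.
Implicit Types A : set (I01 R).
Local Notation v := (@real_of_I01 R).

Lemma real_of_I01_inj : injective v.
Proof. exact: val_inj. Qed.

Lemma real_of_I01_gt0 (x : I01 R) : 0 < v x.
Proof. by have /andP[] := valP (x : oitv01 R). Qed.

Lemma real_of_I01_lt1 (x : I01 R) : v x < 1.
Proof. by have /andP[] := valP (x : oitv01 R). Qed.

Lemma measurable_real_of_I01 : measurable_fun [set: I01 R] v.
Proof. by move=> _ Y mY; exists Y. Qed.

Lemma image_I01_preimage (B : set R) : v @` (v @^-1` B) = B `&` `]0, 1[.
Proof.
apply/seteqP; split => [_ [x Bx <-]|r [Br]].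
  by split=> //=; rewrite in_itv/= real_of_I01_gt0 real_of_I01_lt1.
rewrite /= in_itv/= => r01.
by exists (exist (fun x : R => is_true (0 < x < 1)) r r01 : I01 R).
Qed.

Lemma measurable_image_I01 A : measurable A -> measurable (v @` A).
Proof.
move=> [B mB <-]; rewrite setTI.
rewrite (_ : v @` _ = B `&` `]0, 1[); last exact: image_I01_preimage.
exact: measurableI.
Qed.

Definition lebesgue01 A : \bar R := lebesgue_measure (v @` A).

Let lebesgue01_0 : lebesgue01 set0 = 0%E.
Proof. by rewrite /lebesgue01 image_set0 measure0. Qed.

Let lebesgue01_ge0 A : (0 <= lebesgue01 A)%E.
Proof. exact: measure_ge0. Qed.

Let lebesgue01_sigma_additive : semi_sigma_additive lebesgue01.
Proof.
move=> F mF tF mUF; rewrite /lebesgue01 image_bigcup.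
apply: measure_semi_sigma_additive.
- by move=> n; exact: measurable_image_I01.
- apply/trivIsetP => i j _ _ ij; rewrite -subset0 => r /= [[x Fx <-] [y Fy]].
  move/real_of_I01_inj => yx; rewrite yx in Fy.
  have : (F i `&` F j) x by [].
  by move/trivIsetP : tF => ->.
- by rewrite -image_bigcup; exact: measurable_image_I01.
Qed.

HB.instance Definition _ := isMeasure.Build _ _ _ lebesgue01
  lebesgue01_0 lebesgue01_ge0 lebesgue01_sigma_additive.

Let lebesgue01_setT : lebesgue01 setT = 1%E.
Proof.
rewrite /lebesgue01 -(preimage_setT v) image_I01_preimage setTI.
by rewrite lebesgue_measure_itv/= lte_fin ltr01 sube0.
Qed.

HB.instance Definition _ := Measure_isProbability.Build _ _ _ lebesgue01
  lebesgue01_setT.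

End lebesgue01.

Definition Leb01 (R : realType) : probability (I01 R) R := @lebesgue01 R.

(* [eps i x], i >= 1, is the i-th digit of the binary expansion of x having
   infinitely many digits 0; see [eps_zeros] and [eps_expansion]. *)
Definition eps (R : realType) (i : nat) (x : I01 R) : bool :=
  odd (Num.truncn (2 ^+ i * (x : R))).

Definition digits (R : realType) (n : nat) (x : I01 R) : n.-tuple bool :=
  [tuple eps k.+1 x | k < n].

Section eps_theory.
Context {R : realType}.
Implicit Type x : I01 R.

Lemma truncn_eps x i : Num.truncn (2 ^+ i.+1 * (x : R)) =
  ((Num.truncn (2 ^+ i * (x : R))).*2 + eps i.+1 x)%N.
Proof.
rewrite -[LHS]odd_double_half addnC; congr (_.*2 + _)%N.
set a := Num.truncn (2 ^+ i * _); set b := Num.truncn _.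
have x0 n : 0 <= 2 ^+ n * (x : R) by rewrite mulr_ge0// ltW// real_of_I01_gt0.
have /andP[a1 a2] : a%:R <= 2 ^+ i * (x : R) < a.+1%:R by apply: truncn_itv.
have /andP[b1 b2] : b%:R <= 2 ^+ i.+1 * (x : R) < b.+1%:R by apply: truncn_itv.
rewrite exprS -mulrA in b1 b2.
have h1 : (b < a.*2.+2)%N.
  rewrite -(ltr_nat R); apply: (le_lt_trans b1).
  by rewrite -doubleS -mul2n natrM ltr_pM2l ?ltr0n.
have h2 : (a.*2 < b.+1)%N.
  rewrite -(ltr_nat R); apply: le_lt_trans b2.
  by rewrite -mul2n natrM ler_pM2l ?ltr0n.
lia.
Qed.

Lemma eps_partial_sum x n :
  \sum_(1 <= i < n.+1) (eps i x)%:R / 2 ^+ i =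
  (Num.truncn (2 ^+ n * (x : R)))%:R / 2 ^+ n :> R.
Proof.
elim: n => [|n IH].
  rewrite big_geq// expr0 mul1r divr1 (_ : Num.truncn _ = 0)%N//.
  apply/eqP; rewrite -leqn0 -ltnS truncn_lt_nat ?real_of_I01_lt1//.
  by rewrite ltW// real_of_I01_gt0.
rewrite big_nat_recr//= IH truncn_eps natrD mulrDl; congr (_ + _).
rewrite -mul2n natrM exprS invfM mulrACA divff ?mul1r//.
Qed.

Lemma eps_expansion x :
  \sum_(1 <= i < n.+1) (eps i x)%:R / 2 ^+ i @[n --> \oo] --> (x : R).
Proof.
under eq_fun do rewrite eps_partial_sum.
have x0 := real_of_I01_gt0 x.
have h0 : ((x : R) - 2^-1 ^+ n) @[n --> \oo] --> (x : R).
  rewrite -[X in _ --> X]subr0; apply: cvgB; first exact: cvg_cst.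
  apply: cvg_expr; rewrite ger0_norm ?invr_ge0//.
  by rewrite invf_lt1 ?ltr0n// ltr1n.
apply: (squeeze_cvgr _ h0 (cvg_cst (x : R))).
near=> n.
have p0 : 0 < 2 ^+ n :> R by rewrite exprn_gt0.
have /andP[a1 a2] : (Num.truncn (2 ^+ n * (x : R)))%:R <= 2 ^+ n * (x : R) <
    (Num.truncn (2 ^+ n * (x : R))).+1%:R.
  by apply: truncn_itv; rewrite mulr_ge0// ltW.
apply/andP; split; last by rewrite ler_pdivrMr// [leRHS]mulrC.
rewrite exprVn ler_pdivlMr// mulrBl mulVf ?gt_eqF// [_ * 2 ^+ n]mulrC lerBlDr ltW//.
by rewrite natr1.
Unshelve. all: by end_near. Qed.

Lemma eps_zeros x N : exists2 i, (N <= i)%N & eps i x = false.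
Proof.
apply: contrapT => H.
have one i : (N <= i)%N -> eps i x = true.
  by move=> Ni; apply/negP => /negP/negbTE e; apply: H; exists i.
pose f n : R := 2 ^+ n * (x : R) - (Num.truncn (2 ^+ n * (x : R)))%:R.
have x0 n : 0 <= 2 ^+ n * (x : R) by rewrite mulr_ge0// ltW// real_of_I01_gt0.
have f01 n : 0 <= f n < 1.
  have /andP[h1 h2] := truncn_itv (x0 n); rewrite -natr1 in h2.
  by rewrite /f; apply/andP; split; lra.
have fS n : (N <= n)%N -> 1 - f n.+1 = 2 * (1 - f n).
  move=> Nn; rewrite /f truncn_eps one ?leqW// -mul2n natrD natrM exprS.
  rewrite -mulrA; set a := 2 ^+ n * _; set b := _%:R; rewrite /=.
  have -> : true%:R = 1 :> R by [].
  lra.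
have fk k : 1 - f (N + k)%N = 2 ^+ k * (1 - f N).
  elim: k => [|k IH]; first by rewrite addn0 mul1r.
  by rewrite addnS fS ?leq_addr// IH mulrA exprS.
have d0 : 0 < 1 - f N by rewrite subr_gt0; case/andP: (f01 N).
pose k := (Num.truncn (1 - f N)^-1).+1.
have : (1 - f N)^-1 < k%:R by exact: truncnS_gt.
have : k%:R <= 2 ^+ k :> R by rewrite -natrX ler_nat ltnW// ltn_expl.
move=> h1 /lt_le_trans /(_ h1).
rewrite -[_^-1]mul1r ltr_pdivrMr// -fk.
by have := f01 (N + k)%N; lra.
Qed.

Lemma measurable_eps i : measurable_fun [set: I01 R] (@eps R i).
Proof.
rewrite /eps.
have h : measurable_fun [set: I01 R] (fun x : I01 R => 2 ^+ i * (x : R)).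
  by apply: measurable_funM => //; exact: measurable_real_of_I01.
apply: (measurable_fun_bool true) => /=.
rewrite setTI (_ : _ @^-1` _ = \bigcup_(n in [set n | odd n])
    ((fun x : I01 R => 2 ^+ i * (x : R)) @^-1` `[n%:R, n.+1%:R[)).
  apply: bigcup_measurable => n _; rewrite -[X in measurable X]setTI; exact: h.
have x0 (x : I01 R) : 0 <= 2 ^+ i * (x : R).
  by rewrite mulr_ge0// ltW// real_of_I01_gt0.
apply/seteqP; split => [x /= ox|x [n /= on]].
  exists (Num.truncn (2 ^+ i * (x : R))) => //=.
  by rewrite in_itv/=; exact: truncn_itv.
by rewrite in_itv/= => /truncn_def ->.
Qed.

End eps_theory.

(* Length of the row [rho >= 1]; see [row_lenP]. *)
Definition row_len (M rho : nat) : nat := (rho.-1 %/ M.+1).+1.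

(* Number of integers used up by the rows preceding row [rho], so that the
   [i]-th entry of row [rho] is [row_start M rho + i]. *)
Definition row_start (M rho : nat) : nat := (\sum_(1 <= r < rho) row_len M r)%N.

Definition column (M i : nat) : set nat :=
  [set j | exists2 rho, (0 < rho)%N /\ (i <= row_len M rho)%N &
                        j = (row_start M rho + i)%N].

(* [col_idx M i k] is j_{i,k} for i, k >= 1: the rows of length at least i are
   those of index larger than (i - 1)(M + 1); see [col_idx_ltn] and
   [col_idx_range]. *)
Definition col_idx (M i k : nat) : nat :=
  (row_start M (i.-1 * M.+1 + k) + i)%N.

Lemma row_lenP M rho b : (0 < rho)%N -> (0 < b)%N ->
  ((b.-1 * M.+1 < rho <= b * M.+1)%N <-> b = row_len M rho).
Proof.
case: rho b => // r [//|b] _ _; rewrite /row_len /= ltnS.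
split=> [/andP[h1 h2]|[->]].
  by congr S; apply/eqP; rewrite eqn_leq leq_divRL// h1 -ltnS ltn_divLR.
by rewrite -leq_divRL// leqnn -ltn_divLR//=.
Qed.

Lemma row_len_geq M i k : (0 < i)%N -> (0 < k)%N ->
  (i <= row_len M (i.-1 * M.+1 + k))%N.
Proof.
move=> i0 k0; rewrite /row_len -(prednK k0) addnS /= divnMDl//.
by rewrite -{1}(prednK i0) ltnS leq_addr.
Qed.

Lemma col_idx_ltn M i k : (0 < i)%N -> (0 < k)%N ->
  (col_idx M i k < col_idx M i k.+1)%N.
Proof.
move=> i0 k0; rewrite /col_idx addnS ltn_add2r /row_start.
by rewrite big_nat_recr ?addn_gt0 ?k0 ?orbT//= -addn1 leq_add2l.
Qed.

Lemma col_idx_range M i : (0 < i)%N ->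
  column M i = [set j | exists2 k, (0 < k)%N & j = col_idx M i k].
Proof.
move=> i0; apply/seteqP; split => j [] => [rho [r0 ir] ->|k k0 ->].
  have h : (i.-1 * M.+1 < rho)%N.
    rewrite -(prednK r0) ltnS -leq_divRL// -ltnS prednK//.
  exists (rho - i.-1 * M.+1)%N; first by rewrite subn_gt0.
  by rewrite /col_idx subnKC// ltnW.
exists (i.-1 * M.+1 + k)%N => //; split; last exact: row_len_geq.
by rewrite addn_gt0 k0 orbT.
Qed.

(* The elements of the union of {j_{i,1}, ..., j_{i,M+1}} over 1 <= i <= n, in
   increasing order. *)
Definition Jbar (M n : nat) : seq nat :=
  sort leq (undup [seq col_idx M i k | i <- iota 1 n, k <- iota 1 M.+1]).

Definition col_digits (R : realType) (M i : nat) (x : I01 R) : M.+1.-tuple bool :=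
  [tuple eps (col_idx M i k.+1) x | k < M.+1].

(* R_i(x) is the outcome o_s with (eps_{j_{i,1}}(x), ..., eps_{j_{i,M+1}}(x))
   = varsigma_s.  This makes sense for every x, including those for which no
   point of (0,1) has the digits eps_{j_{i,k}}(x), k >= 1; see [Rcol_iff] and
   [Rcol_comp].  The default 0 is never used when [vs] is a bijection. *)
Definition Rcol (R : realType) (M : nat) (o : 'I_(2 ^ M.+1) -> R)
    (vs : 'I_(2 ^ M.+1) -> M.+1.-tuple bool) (i : nat) (x : I01 R) : R :=
  if [pick s | vs s == col_digits M i x] is Some s then o s else 0.

Definition Ssum (R : realType) (M : nat) (o : 'I_(2 ^ M.+1) -> R)
    (vs : 'I_(2 ^ M.+1) -> M.+1.-tuple bool) (n : nat) (x : I01 R) : R :=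
  \sum_(1 <= i < n.+1) Rcol o vs i x.

Section Rcol_theory.
Context {R : realType} {M : nat}.
Variables (o : 'I_(2 ^ M.+1) -> R) (vs : 'I_(2 ^ M.+1) -> M.+1.-tuple bool).

Lemma Rcol_iff i x s : injective o -> bijective vs ->
  Rcol o vs i x = o s <-> col_digits M i x = vs s.
Proof.
move=> oI [sv vsK svK]; rewrite /Rcol; case: pickP => [t /eqP tE|/(_ (sv _))].
  rewrite -tE; split=> [/oI ->//|/(can_inj vsK) ->//].
by move/(_ (col_digits M i x)); rewrite svK eqxx.
Qed.

Lemma Rcol_comp (O : I01 R -> R) : bijective vs ->
  (forall x s, O x = o s <-> digits M.+1 x = vs s) ->
  forall i x y, (forall k, (0 < k)%N -> eps k y = eps (col_idx M i k) x) ->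
  Rcol o vs i x = O y.
Proof.
move=> [sv vsK svK] OE i x y yE.
have dE : digits M.+1 y = col_digits M i x.
  by apply: eq_from_tnth => k; rewrite !tnth_mktuple yE.
rewrite /Rcol; case: pickP => [t /eqP tE|/(_ (sv _))].
  by apply/esym/OE; rewrite dE tE.
by move/(_ (col_digits M i x)); rewrite svK eqxx.
Qed.

Lemma measurable_Rcol i : measurable_fun [set: I01 R] (Rcol o vs i).
Proof.
have mE (t : M.+1.-tuple bool) :
    measurable ([set x | col_digits M i x = t] : set (I01 R)).
  rewrite (_ : [set _ | _] =
      \bigcap_(k in [set: 'I_M.+1])
        (@eps R (col_idx M i k.+1) @^-1` [set tnth t k])); last first.
    apply/seteqP; split => [x /= <- k _ /=|x /= xE]; first by rewrite tnth_mktuple.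
    by apply: eq_from_tnth => k; rewrite tnth_mktuple xE.
  apply: fin_bigcap_measurable => // k _.
  by rewrite -[X in measurable X]setTI; exact: measurable_eps.
pose g t : R := if [pick s | vs s == t] is Some s then o s else 0.
move=> _ Y mY; rewrite setTI (_ : _ @^-1` _ =
    \bigcup_(t in [set t | Y (g t)]) [set x | col_digits M i x = t]).
  by apply: fin_bigcup_measurable => [|t _]; [exact: finite_finset|exact: mE].
apply/seteqP; split => [x /= Yx|x [t /= Yt xt]].
  by exists (col_digits M i x).
by rewrite /= /Rcol xt.
Qed.

HB.instance Definition _ i := isMeasurableFun.Build _ _ _ _ (Rcol o vs i)
  (measurable_Rcol i).

Lemma measurable_Ssum n : measurable_fun [set: I01 R] (Ssum o vs n).
Proof. by apply: measurable_sum => i; exact: measurable_Rcol. Qed.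

HB.instance Definition _ n := isMeasurableFun.Build _ _ _ _ (Ssum o vs n)
  (measurable_Ssum n).

End Rcol_theory.

Definition quantile (R : realType) (X : {RV (Leb01 R) >-> R}) (x : I01 R) : R :=
  inf [set t : R | ((x : R)%:E < cdf X t)%E].

Definition Sstar (R : realType) (M : nat) (o : 'I_(2 ^ M.+1) -> R)
    (vs : 'I_(2 ^ M.+1) -> M.+1.-tuple bool) (n : nat) : I01 R -> R :=
  quantile (Ssum o vs n).

(* For l = 0 the left endpoint 0 is excluded because points of [I01 R] are
   positive. *)
Definition Dset (R : realType) (M n l : nat) : set (I01 R) :=
  [set x : I01 R | l%:R / 2 ^+ (n * M.+1) <= (x : R) < l.+1%:R / 2 ^+ (n * M.+1)].

(* The l-th vector of {0,1}^N in the lexicographic order, with false < true;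
   N-tuples stand for vectors indexed by [Jbar M n] in increasing order. *)
Definition lexvec (N l : nat) : N.-tuple bool :=
  nth [tuple of nseq N false] (Order.enum {: N.-tuplelexi bool}) l.

Definition Eset (R : realType) (M n l : nat) : set (I01 R) :=
  [set x | [seq eps j x | j <- Jbar M n] = lexvec (n * M.+1) l].

Definition admissible (R : realType) (M : nat) (o : 'I_(2 ^ M.+1) -> R)
    (vs : 'I_(2 ^ M.+1) -> M.+1.-tuple bool) (n : nat)
    (p : {perm 'I_(2 ^ (n * M.+1))}) : Prop :=
  forall (l : 'I_(2 ^ (n * M.+1))) (x y : I01 R),
    Dset M n l x -> Eset M n (p l) y -> Sstar o vs n x = Ssum o vs n y.

Arguments admissible {R M} o vs n p.

Definition trim (R : realType) (M n : nat) (Y : I01 R -> R) : Prop :=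
  forall x y, digits (n * M.+1) x = digits (n * M.+1) y -> Y x = Y y.

Definition mutually_independent d (T : measurableType d) (R : realType)
    (P : probability T R) (I : finType) (X : I -> {RV P >-> R}) : Prop :=
  forall (J : {set I}) (A : I -> set R), (forall i, measurable (A i)) ->
    P (\bigcap_(i in [set` J]) (X i @^-1` A i)) =
    (\prod_(i in J) P (X i @^-1` A i))%E.

Definition identically_distributed d (T : measurableType d) (R : realType)
    (P : probability T R) (I : Type) (X : I -> {RV P >-> R}) : Prop :=
  forall i j (A : set R), measurable A ->
    distribution P (X i) A = distribution P (X j) A.

(* Row [k] of the array is the row of index n = k + 1, and its entry [i] is the
   one of index i + 1. *)
Definition tri_array (R : realType) : Type :=
  forall k : nat, 'I_k.+1 -> {RV (Leb01 R) >-> R}.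

(* Likewise, term [k] is the permutation of index n = k + 1. *)
Definition perm_seq (M : nat) : Type :=
  forall k : nat, {perm 'I_(2 ^ (k.+1 * M.+1))}.

Record trim_strong_rep (R : realType) (M : nat) (o : 'I_(2 ^ M.+1) -> R)
    (S : nat -> I01 R -> R) (A : tri_array R) : Prop := {
  rep_independent : forall k, mutually_independent (@A k);
  rep_identical : forall k, identically_distributed (@A k);
  rep_trim : forall k i, trim M k.+1 (@A k i);
  rep_mean : forall k i, ('E_(Leb01 R)[@A k i] = 0)%E;
  rep_variance : forall k i, ('V_(Leb01 R)[@A k i] = 1)%E;
  rep_outcomes : forall k i, range (@A k i) = range o;
  rep_uniform : forall k i s,
    Leb01 R (@A k i @^-1` [set o s]) = ((2 ^+ M.+1)^-1)%:E;
  rep_sum : forall k x, S k.+1 x = \sum_(i < k.+1) @A k i x }.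

(* Main.v *)
Require Import Defs.
From HB Require Import structures.
From mathcomp Require Import all_boot all_order perm all_algebra.
From mathcomp Require Import all_classical all_reals all_analysis.
From mathcomp Require Import lra zify.

(** Put N = n(M+1). The unit interval is cut in two ways into 2^N pieces of equal
    weight: the dyadic intervals D_l, and the cells E_l on which the digits read
    by the first n columns are prescribed. The columns are disjoint, so these
    digits are N distinct ones, split into n blocks of M+1. Hence listing the
    blocks read on E_l is a bijection [column_code] from the indices l to the
    n-tuples of blocks ([column_code_bij]), and R_i takes on E_l the outcome
    named by the i-th block ([Rcol_column_code]).

    An n-trim row of n variables with the outcomes of O as values is the same
    thing as a map U from the indices of the dyadic intervals to n-tuples of
    blocks. As l is uniformly distributed, the row is i.i.d. with uniform
    outcomes exactly when U is a bijection. One direction is a count: if U is a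
    bijection, then the n-tuple of blocks is uniform on a finite product, and so
    has independent uniform coordinates ([uniform_ffun_marginal],
    [uniform_ffun_independent]). In the other direction, independence gives every
    n-tuple of outcomes a positive probability, so U is onto, and the two finite
    sets have the same size ([iid_row_coded]).

    Composing with the bijection [column_code] thus identifies the permutations
    of the indices with the rows that are i.i.d., trim and uniform. Under this
    identification admissibility says that the row sums to the quantile of S_n
    ([admissibleP]), which is the remaining requirement on a row. The mean and
    the variance of an entry are those of O, since both have the form g(Z) with
    the same g and Z uniform on the blocks. *)

Set Implicit Arguments.
Unset Strict Implicit.
Unset Printing Implicit Defensive.

Import Order.TTheory GRing.Theory Num.Theory.
Import numFieldNormedType.Exports.

Local Open Scope classical_set_scope.
Local Open Scope ring_scope.

(** * Uniform random elements of finite types *)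

Section uniform.
Context {d} {T : measurableType d} {R : realType} (P : probability T R).

Definition uniform (V : finType) (Z : T -> V) : Prop :=
  forall v, measurable (Z @^-1` [set v]) /\
            P (Z @^-1` [set v]) = (#|V|%:R^-1)%:E.

Section one_element.
Context {V : finType} {Z : T -> V}.
Hypothesis unifZ : uniform Z.

Lemma uniform_measurable_preimage (B : set V) : measurable (Z @^-1` B).
Proof.
rewrite (_ : Z @^-1` B = \bigcup_(v in B) Z @^-1` [set v]).
  by apply: fin_bigcup_measurable => [|v _];
    [exact: finite_finset|exact: (unifZ v).1].
apply/seteqP; split => [x Bx|x [v Bv /= ->//]].
by exists (Z x).
Qed.

Lemma uniform_measurable_comp (h : V -> R) : measurable_fun setT (h \o Z).
Proof.
move=> _ Y _; rewrite setTI comp_preimage; exact: uniform_measurable_preimage.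
Qed.

Lemma uniform_expectation (h : V -> R) :
  ('E_P[h \o Z])%E = (#|V|%:R^-1 * \sum_v h v)%:E.
Proof.
rewrite unlock.
have hE x : ((h \o Z) x)%:E =
    (\sum_v (h v)%:E * (\1_(Z @^-1` [set v]) x)%:E)%E.
  rewrite (bigD1 (Z x))//= big1 => [|v vx]; last first.
    by rewrite indicE memNset ?mule0//= => /eqP; rewrite eq_sym (negbTE vx).
  by rewrite adde0 indicE mem_set//= mule1.
have int v : P.-integrable setT (fun x => (\1_(Z @^-1` [set v]) x)%:E).
  exact: integrable_indic (unifZ v).1.
under eq_integral do rewrite hE.
rewrite integral_sum// => [|v]; last exact: integrableZl.
rewrite mulr_sumr -sumEFin; apply: eq_bigr => v _.
have [mZv Zv] := unifZ v.
rewrite integralZl// integral_indic// setIT.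
by rewrite [X in (_ * X)%E]Zv muleC.
Qed.

Lemma uniform_variance (h : V -> R) (m := #|V|%:R^-1 * \sum_v h v) :
  ('V_P[h \o Z])%E = (#|V|%:R^-1 * \sum_v (h v - m) ^+ 2)%:E.
Proof.
rewrite -(uniform_expectation (fun v => (h v - m) ^+ 2)).
by rewrite /variance unlock uniform_expectation.
Qed.

(** The probability of an event is the expectation of its indicator. *)
Lemma uniform_probability (B : {pred V}) :
  P (Z @^-1` [set` B]) = (#|B|%:R / #|V|%:R)%:E.
Proof.
have mB := uniform_measurable_preimage [set` B].
rewrite -(expectation_indic _ mB).
rewrite (_ : \1_(_ @^-1` _) = (fun v => (v \in B)%:R) \o Z).
  by rewrite uniform_expectation -natr_sum mulrC -sum1_card [in RHS]big_mkcond.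
apply/funext => x; rewrite indicE; congr (nat_of_bool _)%:R.
by apply/idP/idP; rewrite inE.
Qed.

Lemma uniform_bij (W : finType) (h : V -> W) :
  bijective h -> uniform (h \o Z).
Proof.
move=> bh; have [g hK gK] := bh => w.
rewrite (_ : _ @^-1` _ = Z @^-1` [set g w]).
  by rewrite -(bij_eq_card bh); exact: unifZ.
apply/seteqP; split => x /=; first by move=> <-; rewrite hK.
by move=> ->; rewrite gK.
Qed.

End one_element.

Section product.
Context {I V : finType} {U : T -> {ffun I -> V}}.
Hypothesis unifU : uniform U.

(** The functions with prescribed values in [B i] for [i] in [J] form a product
    of finite sets; each coordinate outside [J] contributes a factor 1. *)
Lemma uniform_ffun_prob (J : {set I}) (B : I -> {pred V}) :
  P (\bigcap_(i in [set` J]) (fun x => U x i) @^-1` [set` B i]) =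
  (\prod_(i in J) (#|B i|%:R / #|V|%:R))%:E.
Proof.
pose F i : pred V := if i \in J then [pred v in B i] else predT.
rewrite (_ : \bigcap_(i in _) _ = U @^-1` [set` family F]); last first.
  apply/seteqP; split => x /=.
    move=> UB; apply/familyP => i; rewrite /F; case: ifP => // iJ.
    exact: UB.
  move=> /familyP UF i /= iJ; have := UF i; by rewrite /F iJ.
rewrite uniform_probability// card_family card_ffun.
have -> : foldr muln 1%N [seq #|F i| | i : I] = (\prod_i #|F i|)%N.
  by rewrite /image_mem -big_enum/= foldrE big_map.
have V0 (i : I) : #|V|%:R != 0 :> R.
  by rewrite pnatr_eq0 -lt0n; apply/card_gt0P; exists (U point i).
rewrite natr_prod natrX -prodr_const -prodf_div big_mkcond/= [in RHS]big_mkcond/=.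
congr EFin; apply: eq_bigr => i _; rewrite /F; case: ifP => // _.
by rewrite divff// V0.
Qed.
Lemma uniform_ffun_marginal i : uniform (fun x => U x i).
Proof.
move=> v; split.
  exact: (uniform_measurable_preimage unifU [set f | f i = v]).
have := uniform_ffun_prob [set i]%SET (fun=> pred1 v).
rewrite big_set1 card1 div1r => <-; congr (P _).
have -> : [set` [set i]%SET] = [set i].
  by apply/seteqP; split => j /=; rewrite inE => /eqP.
by rewrite bigcap_set1; apply/seteqP; split => x /eqP.
Qed.

Lemma uniform_ffun_independent (X : I -> {RV P >-> R}) (f : V -> R) :
  (forall i x, X i x = f (U x i)) -> mutually_independent X.
Proof.
move=> XE J A _.
have XA i : X i @^-1` A i =
    (fun x => U x i) @^-1` [set` [pred v | `[< A i (f v) >]]].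
  by apply/seteqP; split => x; rewrite /= XE => /asboolP.
under eq_bigcapr do rewrite XA.
rewrite uniform_ffun_prob -prodEFin; apply: eq_bigr => i _.
by rewrite XA (uniform_probability (uniform_ffun_marginal i)).
Qed.

End product.
End uniform.

(** * Dyadic cells *)

Section cells.
Context {R : realType}.
Implicit Types x y : I01 R.

Lemma scaled_ge0 n x : 0 <= 2 ^+ n * (x : R).
Proof. by rewrite mulr_ge0 ?exprn_ge0// ltW ?real_of_I01_gt0. Qed.

Lemma truncn_scaled_lt n x : (Num.truncn (2 ^+ n * (x : R)) < 2 ^ n)%N.
Proof.
rewrite truncn_lt_nat ?scaled_ge0// natrX -[ltRHS]mulr1.
by rewrite ltr_pM2l ?exprn_gt0// real_of_I01_lt1.
Qed.

Definition cell n x : 'I_(2 ^ n) := Ordinal (truncn_scaled_lt n x).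

Lemma cellP n x (l : 'I_(2 ^ n)) :
  cell n x = l <-> l%:R / 2 ^+ n <= (x : R) < l.+1%:R / 2 ^+ n.
Proof.
rewrite ler_pdivrMr ?exprn_gt0// ltr_pdivlMr ?exprn_gt0// ![_ * 2 ^+ n]mulrC.
rewrite -truncn_eq ?scaled_ge0//.
by split => [<-//|/eqP xl]; apply/val_inj.
Qed.

Lemma cell_surj n (l : 'I_(2 ^ n)) : exists x, cell n x = l.
Proof.
have n0 : 0 < 2 ^+ n :> R by rewrite exprn_gt0.
have h01 : 0 < ((l%:R + 2^-1) / 2 ^+ n : R) < 1.
  rewrite divr_gt0 ?ltr_wpDl ?invr_gt0//= ltr_pdivrMr// mul1r.
  have : l.+1%:R <= 2 ^+ n :> R by rewrite -natrX ler_nat.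
  by apply: lt_le_trans; rewrite -[l.+1%:R]natr1 ltrD2l invf_lt1// ltr1n.
(* The midpoint, because the left endpoint of the first interval is excluded. *)
exists (exist (fun x : R => is_true (0 < x < 1)) _ h01 : I01 R).
apply/cellP; rewrite /real_of_I01/val01/=.
rewrite ler_pM2r ?invr_gt0// ltr_pM2r ?invr_gt0// -[l.+1%:R]natr1; lra.
Qed.

Definition cell_point n (l : 'I_(2 ^ n)) : I01 R :=
  xget point [set x | cell n x = l].

Lemma cell_pointK n : cancel (@cell_point n) (@cell n).
Proof.
move=> l; have [x xl] := cell_surj l.
by have : [set y | cell n y = l] (cell_point l) by apply: xgetPex; exists x.
Qed.

Lemma uniform_cell n : uniform (Leb01 R) (@cell n).
Proof.
move=> l; pose a : R := l%:R / 2 ^+ n; pose b : R := l.+1%:R / 2 ^+ n.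
have n0 : 0 < 2 ^+ n :> R by rewrite exprn_gt0.
have -> : cell n @^-1` [set l] = @real_of_I01 R @^-1` `[a, b[.
  by apply/seteqP; split => x /=; rewrite in_itv => /cellP.
split.
  rewrite -[X in measurable X]setTI.
  exact: (measurable_real_of_I01 measurableT).
rewrite /= /lebesgue01 image_I01_preimage card_ord natrX.
have b1 : b <= 1 by rewrite ler_pdivrMr// mul1r -natrX ler_nat.
have ab : b - a = (2 ^+ n)^-1 by rewrite -mulrBl -natr1 addrC addKr div1r.
have a_lt_b : a < b by rewrite -subr_gt0 ab invr_gt0.
have : 0 <= a by rewrite divr_ge0// ltW.
rewrite le_eqVlt => /predU1P[a0|a0].
  rewrite (_ : _ `&` _ = `]0, b[%classic).
    by rewrite lebesgue_measure_itv/= lte_fin a0 a_lt_b -EFinD ab.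
  apply/seteqP; split => x /=; rewrite !in_itv/= -a0.
    by move=> [/andP[_ ->] /andP[->]].
  by move=> /andP[x0 xb]; rewrite xb (ltW x0) x0 (lt_le_trans xb).
rewrite (_ : _ `&` _ = `[a, b[%classic).
  by rewrite lebesgue_measure_itv/= lte_fin a_lt_b -EFinD ab.
apply/seteqP; split => x /=; rewrite !in_itv/=; first by case.
by move=> /andP[ax xb]; rewrite ax xb (lt_le_trans a0)// (lt_le_trans xb).
Qed.

(** Doubling [2 ^+ n * x] appends one binary digit to its integer part, which
    therefore records the first [n] digits of [x]. *)
Lemma truncn_scaled_eq n x y :
  Num.truncn (2 ^+ n * (x : R)) = Num.truncn (2 ^+ n * (y : R)) <->
  forall k, (0 < k <= n)%N -> eps k x = eps k y.
Proof.
elim: n => [|n IH].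
  have trunc0 (z : I01 R) : Num.truncn (2 ^+ 0 * (z : R)) = 0%N.
    by have := truncn_scaled_lt 0 z; rewrite expn0 ltnS leqn0 => /eqP.
  by split=> [_ k|_]; [lia|rewrite !trunc0].
rewrite !truncn_eps; split => [tE k kn|eE].
  have [tnE enE] :
      Num.truncn (2 ^+ n * (x : R)) = Num.truncn (2 ^+ n * (y : R)) /\
      eps n.+1 x = eps n.+1 y by case: (eps _ x) tE; case: (eps _ y); lia.
  have [->//|kSn] := eqVneq k n.+1.
  by apply: (IH.1 tnE); lia.
rewrite eE ?ltnSn// (IH.2 _)// => k kn; apply: eE; lia.
Qed.

Lemma digits_cell n x y : digits n x = digits n y <-> cell n x = cell n y.
Proof.
split=> [dE|cE].
  apply/val_inj/truncn_scaled_eq => -[//|k] kn.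
  by have := congr1 (fun t => tnth t (Ordinal kn)) dE; rewrite !tnth_mktuple.
apply: eq_from_tnth => k; rewrite !tnth_mktuple.
by move/(congr1 val)/truncn_scaled_eq : cE; apply; exact: ltn_ord.
Qed.

(** The points [cell_point l] have distinct digits, and there are as many of
    them as tuples of digits. *)
Lemma exists_digits n (t : n.-tuple bool) : exists x, digits n x = t.
Proof.
have /inj_card_bij[|g _ gK] :
    injective (fun l : 'I_(2 ^ n) => digits n (cell_point l)).
- by move=> l l' /digits_cell; rewrite !cell_pointK.
- by rewrite card_tuple card_bool card_ord.
by exists (cell_point (g t)).
Qed.

Lemma exists_eps (J : seq nat) (e : nat -> bool) :
  all (leq 1) J -> exists x, forall j, j \in J -> eps j x = e j.
Proof.
move=> /allP J0; pose N := (\max_(j <- J) j)%N.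
have [x xE] := exists_digits [tuple e k.+1 | k < N].
exists x => j jJ; have := J0 j jJ; case: j jJ => // j jJ _.
have jN : (j < N)%N by rewrite /N (big_rem _ jJ) /= leq_max leqnn.
by have := congr1 (fun t => tnth t (Ordinal jN)) xE; rewrite !tnth_mktuple.
Qed.

End cells.

(** * The blocks of digits read by the columns *)

Lemma row_startS M rho : (0 < rho)%N ->
  row_start M rho.+1 = (row_start M rho + row_len M rho)%N.
Proof. by move=> rho0; rewrite /row_start big_nat_recr. Qed.

Lemma leq_row_start M : {homo row_start M : r r' / (r <= r')%N}.
Proof.
move=> r r' rr'; rewrite /row_start; case: r rr' => [|r] rr'.
  by rewrite big_geq.
by rewrite [leqRHS](big_cat_nat _ rr')//= leq_addr.
Qed.

(** An entry of an earlier row is smaller than an entry of a later one, so equal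
    entries lie in the same row, hence in the same column. *)
Lemma col_idx_inj M i k i' k' :
  (0 < i)%N -> (0 < k)%N -> (0 < i')%N -> (0 < k')%N ->
  col_idx M i k = col_idx M i' k' -> i = i' /\ k = k'.
Proof.
have lt_rows a r b s : (0 < r < s)%N -> (a <= row_len M r)%N -> (0 < b)%N ->
    (row_start M r + a < row_start M s + b)%N.
  move=> /andP[r0 rs] ar b0; have := leq_row_start M rs.
  by rewrite (row_startS M r0) => le_rs; lia.
move=> i0 k0 i'0 k'0; rewrite /col_idx.
have := row_len_geq M i0 k0; have := row_len_geq M i'0 k'0.
set r := (_ + k)%N; set r' := (_ + k')%N => hi' hi e.
have r0 : (0 < r)%N by rewrite addn_gt0 k0 orbT.
have r'0 : (0 < r')%N by rewrite addn_gt0 k'0 orbT.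
case: (ltngtP r r') => rr'.
- by have := lt_rows _ r _ r' _ hi i'0; rewrite r0 rr' e ltnn => /(_ isT).
- by have := lt_rows _ r' _ r _ hi' i0; rewrite r'0 rr' e ltnn => /(_ isT).
have ii' : i = i' by move: e; rewrite rr' => /addnI.
by split=> //; move: rr'; rewrite /r /r' ii' => /addnI.
Qed.

Lemma mem_Jbar M n j :
  j \in Jbar M n <->
  exists i k, [/\ (0 < i <= n)%N, (0 < k <= M.+1)%N & j = col_idx M i k].
Proof.
rewrite mem_sort mem_undup; split=> [/allpairsP[[i k] []]|[i [k [hi hk ->]]]].
  by rewrite !mem_iota /= => hi hk ->; exists i, k; split=> //; lia.
by apply: allpairs_f; rewrite mem_iota; lia.
Qed.

Lemma uniq_Jbar M n : uniq (Jbar M n).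
Proof. by rewrite sort_uniq undup_uniq. Qed.

Lemma size_Jbar M n : size (Jbar M n) = (n * M.+1)%N.
Proof.
rewrite size_sort undup_id ?size_allpairs ?size_iota//.
apply: allpairs_uniq; rewrite ?iota_uniq// => ? ?.
move=> /allpairsP[[i k] [hi hk ->]] /allpairsP[[i' k'] [hi' hk' ->]].
move: hi hk hi' hk'; rewrite !mem_iota /=.
move=> /andP[hi _] /andP[hk _] /andP[hi' _] /andP[hk' _] e.
by have [-> ->] := col_idx_inj hi hk hi' hk' e.
Qed.

Lemma lexvec_inj (N : nat) : {in gtn (2 ^ N)%N &, injective (lexvec N)}.
Proof.
move=> l l' hl hl' /eqP; rewrite /lexvec nth_uniq ?sort_uniq ?enum_uniq//.
- by move/eqP.
- by rewrite size_sort -cardE card_tuple card_bool.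
- by rewrite size_sort -cardE card_tuple card_bool.
Qed.

Section columns.
Context {R : realType} (M : nat).
Implicit Types x y : I01 R.

(** The indices in [Jbar M n] are distinct, positive and [n * M.+1] in number, so
    the digits at these indices can be prescribed freely. *)
Lemma Eset_nonempty n l : exists x : I01 R, Eset M n l x.
Proof.
have [|x xE] := @exists_eps R (Jbar M n)
  (fun j => nth false (lexvec (n * M.+1) l) (index j (Jbar M n))).
  by apply/allP => j /mem_Jbar[i [k [/andP[i0 _] _ ->]]]; rewrite addn_gt0 i0 orbT.
exists x; apply: (@eq_from_nth _ false).
  by rewrite size_map size_Jbar size_tuple.
move=> a; rewrite size_map => aJ.
by rewrite (nth_map 0)// xE ?mem_nth// index_uniq// uniq_Jbar.
Qed.

Lemma Eset_col_digits n l l' x y : Eset M n l x -> Eset M n l' y ->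
  (forall i, (0 < i <= n)%N -> col_digits M i x = col_digits M i y) <->
  lexvec (n * M.+1) l = lexvec (n * M.+1) l'.
Proof.
rewrite /Eset /= => xE yE; split => [xy|ll' i hi].
  apply: val_inj; rewrite /= -xE -yE; apply/eq_in_map => j.
  move=> /mem_Jbar[i [[|k] [hi //]]] hk ->.
  have := congr1 (fun t => tnth t (Ordinal (hk : (k < M.+1)%N))) (xy i hi).
  by rewrite !tnth_mktuple.
apply: eq_from_tnth => k; rewrite !tnth_mktuple.
move: xE; rewrite ll' -yE => /eq_in_map; apply; apply/mem_Jbar.
by exists i, k.+1; split=> //; rewrite /= ltn_ord.
Qed.

(** The blocks of digits that the first [n] columns read on [Eset M n l]; by
    [column_codeE] every point of [Eset M n l] gives the same blocks. *)
Definition column_code n (l : 'I_(2 ^ (n * M.+1))) :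
    {ffun 'I_n -> M.+1.-tuple bool} :=
  [ffun i : 'I_n => col_digits M i.+1 (xget point (Eset (R := R) M n l))].

Lemma column_codeE n (l : 'I_(2 ^ (n * M.+1))) (i : 'I_n) y :
  Eset M n l y -> column_code l i = col_digits M i.+1 y.
Proof.
move=> yE; rewrite ffunE.
have /Eset_col_digits/(_ yE) := xgetPex point (Eset_nonempty n l).
by move=> [_ /(_ erefl)]; apply; rewrite /= ltn_ord.
Qed.

(** The blocks determine all digits with index in [Jbar M n], hence the cell;
    surjectivity follows by counting. *)
Lemma column_code_bij n : bijective (@column_code n).
Proof.
apply: inj_card_bij; last first.
  by rewrite card_ffun card_tuple card_bool !card_ord -expnM mulnC.
move=> l l' ll'; apply/val_inj/(@lexvec_inj (n * M.+1)); rewrite ?inE ?ltn_ord//.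
have [x xl] := Eset_nonempty n l; have [y yl] := Eset_nonempty n l'.
apply/(Eset_col_digits xl yl) => -[//|i] hi.
by rewrite -(column_codeE (Ordinal hi) xl) ll' (column_codeE (Ordinal hi) yl).
Qed.

End columns.

(** * Rows of independent outcomes and bijective codes *)

Section cell_fun.
Context {R : realType} {n : nat}.

Definition cell_fun (h : 'I_(2 ^ n) -> R) (x : I01 R) : R := h (cell n x).

Lemma measurable_cell_fun h : measurable_fun setT (cell_fun h).
Proof. exact: (uniform_measurable_comp (@uniform_cell R n)). Qed.

HB.instance Definition _ h := isMeasurableFun.Build _ _ _ _ (cell_fun h)
  (measurable_cell_fun h).

End cell_fun.

Lemma uniform_digits (R : realType) n : uniform (Leb01 R) (@digits R n).
Proof.
have bij : bijective (fun l : 'I_(2 ^ n) => digits n (@cell_point R n l)).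
  apply: inj_card_bij; last by rewrite card_tuple card_bool card_ord.
  by move=> l l' /digits_cell; rewrite !cell_pointK.
have := uniform_bij (@uniform_cell R n) bij.
rewrite (_ : _ \o _ = @digits R n)//; apply/funext => x /=.
by apply/digits_cell; rewrite cell_pointK.
Qed.

Section rows.
Context {R : realType} (M : nat) (g : M.+1.-tuple bool -> R).
Hypothesis g_inj : injective g.
Context (o : 'I_(2 ^ M.+1) -> R) (vs : 'I_(2 ^ M.+1) -> M.+1.-tuple bool).
Hypothesis vs_bij : bijective vs.
Hypothesis oE : forall s, o s = g (vs s).

Lemma Rcol_code i (x : I01 R) : Rcol o vs i x = g (col_digits M i x).
Proof.
have [sv vsK svK] := vs_bij.
rewrite /Rcol; case: pickP => [s /eqP <-|/(_ (sv (col_digits M i x)))].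
  exact: oE.
by rewrite svK eqxx.
Qed.

Lemma range_code : range g = range o.
Proof.
have [sv vsK svK] := vs_bij; apply/seteqP; split => _ [u _ <-].
  by exists (sv u) => //; rewrite oE svK.
by exists (vs u) => //; rewrite oE.
Qed.

Section row.
Context (n : nat) (A : 'I_n -> {RV (Leb01 R) >-> R}).

Definition coded_by
    (U : 'I_(2 ^ (n * M.+1)) -> {ffun 'I_n -> M.+1.-tuple bool}) : Prop :=
  forall i x, A i x = g (U (cell _ x) i).

Section coded_row.
Context (U : 'I_(2 ^ (n * M.+1)) -> {ffun 'I_n -> M.+1.-tuple bool}).
Hypotheses (U_bij : bijective U) (AU : coded_by U).

Let unifU : uniform (Leb01 R) (U \o cell (n * M.+1)).
Proof. exact: (uniform_bij (@uniform_cell R _) U_bij). Qed.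

Let unifUi i : uniform (Leb01 R) (fun x => U (cell (n * M.+1) x) i).
Proof. exact: (uniform_ffun_marginal unifU). Qed.

Let AE i : A i = g \o (fun x => U (cell _ x) i) :> (I01 R -> R).
Proof. by apply/funext => x; exact: AU. Qed.

Lemma coded_mean i :
  ('E_(Leb01 R)[A i])%E = ('E_(Leb01 R)[g \o digits M.+1])%E.
Proof.
rewrite AE (uniform_expectation (unifUi i)).
by rewrite (uniform_expectation (@uniform_digits R _)).
Qed.

Lemma coded_variance i :
  ('V_(Leb01 R)[A i])%E = ('V_(Leb01 R)[g \o digits M.+1])%E.
Proof.
rewrite AE (uniform_variance (unifUi i)).
by rewrite (uniform_variance (@uniform_digits R _)).
Qed.

Lemma coded_prob i t :
  Leb01 R (A i @^-1` [set g t]) = ((2 ^+ M.+1)^-1)%:E.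
Proof.
rewrite -natrX -[in RHS]card_bool -card_tuple -(unifUi i t).2; congr (Leb01 R _).
apply/seteqP; split => x /=; rewrite AU; first exact: g_inj.
by move=> ->.
Qed.

Lemma coded_independent : mutually_independent A.
Proof. exact: (uniform_ffun_independent unifU AU). Qed.

Lemma coded_range i : range (A i) = range g.
Proof.
have [V UK VK] := U_bij; apply/seteqP; split => _ [u _ <-].
  by rewrite AU; exists (U (cell _ u) i).
exists (cell_point (V [ffun=> u])) => //.
by rewrite AU cell_pointK VK ffunE.
Qed.

Lemma coded_identical : identically_distributed A.
Proof.
move=> i j B mB; rewrite /distribution /pushforward.
have AB k : A k @^-1` B = (fun x => U (cell (n * M.+1) x) k) @^-1`
    [set` [pred t | `[< B (g t) >]]].
  by apply/seteqP; split => x; rewrite /= AU => /asboolP.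
by rewrite !AB !(uniform_probability (unifUi _)).
Qed.

Lemma coded_trim i : trim M n (A i).
Proof. by move=> x y /digits_cell xy; rewrite !AU xy. Qed.

End coded_row.

(** A trim row is a function [U] of the dyadic cell. By independence every tuple
    of outcomes has probability [(2 ^- M.+1) ^+ n], which is positive, so [U]
    is onto, and its source and target have the same cardinality. *)
Lemma iid_row_coded :
  mutually_independent A -> (forall i, trim M n (A i)) ->
  (forall i, range (A i) `<=` range g) ->
  (forall i t, Leb01 R (A i @^-1` [set g t]) = ((2 ^+ M.+1)^-1)%:E) ->
  exists2 U, bijective U & coded_by U.
Proof.
move=> indA trimA rangeA unifA.
have /choice[U0 U0E] (li : 'I_(2 ^ (n * M.+1)) * 'I_n) :
    exists t, g t = A li.2 (cell_point li.1).
  have [|t _ <-] := rangeA li.2 (A li.2 (cell_point li.1)).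
    by exists (cell_point li.1).
  by exists t.
pose U l := [ffun i => U0 (l, i)].
have AU : coded_by U.
  move=> i x; rewrite ffunE U0E/=; apply: trimA.
  by apply/digits_cell; rewrite cell_pointK.
exists U => //.
have Usurj f : exists l, U l = f.
  have : Leb01 R (\bigcap_(i in [set` [set: 'I_n]%SET])
      (A i @^-1` [set g (f i)])) != 0%E.
    rewrite (indA _ (fun i => [set g (f i)])) => [|//].
    under eq_bigr do rewrite unifA.
    by rewrite prodEFin eqe; apply/prodf_neq0 => i _; rewrite invr_eq0 expf_neq0.
  apply: contra_neqP => /forallNP Uf; rewrite -[RHS](measure0 (Leb01 R)).
  congr (Leb01 R _); apply/seteqP; split => // x xf.
  apply: (Uf (cell _ x)); apply/ffunP => i; apply: g_inj.
  by rewrite -AU; apply: xf; rewrite /= inE.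
have /choice[V VK] := Usurj.
have VI : injective V by exact: (can_inj VK).
have card : #|{ffun 'I_n -> M.+1.-tuple bool}| = #|'I_(2 ^ (n * M.+1))|.
  by rewrite card_ffun card_tuple card_bool !card_ord -expnM mulnC.
by apply: (bij_can_bij _ VK); apply: inj_card_bij => //; rewrite card.
Qed.

End row.
End rows.

(** * Admissible permutations and array rows *)

Section arrays.
Context {R : realType} (M : nat) (g : M.+1.-tuple bool -> R).
Context (o : 'I_(2 ^ M.+1) -> R) (vs : 'I_(2 ^ M.+1) -> M.+1.-tuple bool).
Hypothesis vs_bij : bijective vs.
Hypothesis oE : forall s, o s = g (vs s).

Definition perm_array (p : perm_seq M) : tri_array R := fun k i =>
  cell_fun (fun l => g (column_code (R := R) (p k l) i)).

Lemma Dset_cell n (l : 'I_(2 ^ (n * M.+1))) (x : I01 R) :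
  Dset M n l x <-> cell _ x = l.
Proof. exact: iff_sym (cellP x l). Qed.

Lemma Rcol_column_code n (l : 'I_(2 ^ (n * M.+1))) (i : 'I_n) (y : I01 R) :
  Eset M n l y -> Rcol o vs i.+1 y = g (column_code (R := R) l i).
Proof. by move=> yl; rewrite (Rcol_code vs_bij oE) (column_codeE _ yl). Qed.

(** As no [Eset M n l] is empty, admissibility constrains [p] at every index. *)
Lemma admissibleP n (p : {perm 'I_(2 ^ (n * M.+1))}) :
  admissible (R := R) o vs n p <->
  forall x : I01 R,
    Sstar o vs n x = \sum_(i < n) g (column_code (R := R) (p (cell _ x)) i).
Proof.
have SE (l : 'I_(2 ^ (n * M.+1))) (y : I01 R) : Eset M n l y ->
    Ssum o vs n y = \sum_(i < n) g (column_code (R := R) l i).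
  move=> yl; rewrite /Ssum big_add1 big_mkord; apply: eq_bigr => i _.
  exact: Rcol_column_code.
split=> [adm x|S l x y /Dset_cell xl yl].
  have [y yE] := @Eset_nonempty R M n (p (cell _ x)).
  rewrite -(SE _ _ yE); apply: adm yE; exact/Dset_cell.
by rewrite S xl (SE _ _ yl).
Qed.

End arrays.

Theorem corollary1 (R : realType) (M : nat)
    (X : {RV (Leb01 R) >-> R})
    (X_bij : exists2 g : M.+1.-tuple bool -> R,
              injective g & forall x, X x = g (digits M.+1 x))
    (o : 'I_(2 ^ M.+1) -> R)
    (o_incr : forall s t : 'I_(2 ^ M.+1), (s < t)%N -> o s < o t)
    (o_outcomes : range X = range o)
    (o_sum : \sum_s o s = 0)
    (X_var : ('V_(Leb01 R)[X] = 1)%E)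
    (vs : 'I_(2 ^ M.+1) -> M.+1.-tuple bool)
    (vs_code : forall x s, X x = o s <-> digits M.+1 x = vs s) :
  exists Phi : perm_seq M -> tri_array R,
    set_bij [set p : perm_seq M | forall k, admissible o vs k.+1 (p k)]
            [set A : tri_array R | trim_strong_rep o (Sstar o vs) A]
            Phi
    /\
    forall p : perm_seq M, (forall k, admissible o vs k.+1 (p k)) ->
      forall (k : nat) (l : 'I_(2 ^ (k.+1 * M.+1))) (i : 'I_k.+1) (x y : I01 R),
        Dset M k.+1 l x -> Eset M k.+1 (p k l) y ->
        Phi p k i x = Rcol o vs i.+1 y.
Proof.
have [g g_inj XE] := X_bij.
have oE s : o s = g (vs s).
  have [x xs] := @exists_digits R _ (vs s).
  by rewrite -xs -XE; apply/esym/vs_code.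
have vs_bij : bijective vs.
  apply: inj_card_bij; last by rewrite card_tuple card_bool card_ord.
  have o_inj : injective o.
    move=> s t st; apply/val_inj; case: (ltngtP s t) => // /o_incr;
    by rewrite st ltxx.
  by move=> s t st; apply: o_inj; rewrite !oE st.
have Xg : X = g \o digits M.+1 :> (I01 R -> R) by apply/funext => x; exact: XE.
have X_mean : ('E_(Leb01 R)[g \o digits M.+1] = 0)%E.
  rewrite (uniform_expectation (@uniform_digits R _)) (reindex vs)/=; last first.
    exact: onW_bij.
  by under eq_bigr do rewrite -oE; rewrite o_sum mulr0.
exists (@perm_array R M g); split; last first.
  move=> p _ k l i x y /Dset_cell xl yl.
  by rewrite (Rcol_column_code vs_bij oE _ yl) -xl.
split.
- move=> p adm.
  have bij k : bijective (fun l => column_code (R := R) (p k l)).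
    exact: (bij_comp (@column_code_bij R M k.+1) (injF_bij (@perm_inj _ (p k)))).
  have coded k : coded_by g (@perm_array R M g p k)
      (fun l => column_code (R := R) (p k l)) by [].
  split=> k.
  + exact: coded_independent (bij k) (coded k).
  + exact: coded_identical (bij k) (coded k).
  + by move=> i x y; apply: (coded_trim (coded k)).
  + by move=> i; rewrite (coded_mean (bij k) (coded k)).
  + by move=> i; rewrite (coded_variance (bij k) (coded k)) -Xg.
  + by move=> i; rewrite (coded_range (bij k) (coded k)) (range_code vs_bij oE).
  + by move=> i s; rewrite oE (coded_prob g_inj (bij k) (coded k)).
  + exact: ((admissibleP vs_bij oE (p k)).1 (adm k)).
- move=> p q _ _ pq; apply: functional_extensionality_dep => k; apply/permP => l.
  apply: (bij_inj (@column_code_bij R M k.+1)); apply/ffunP => i; apply: g_inj.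
  have := congr1 (fun A : tri_array R => A k i (cell_point l)) pq.
  by rewrite /= /cell_fun cell_pointK.
- move=> A repA.
  have exU k : exists U : 'I_(2 ^ (k.+1 * M.+1)) -> _,
      bijective U /\ coded_by g (@A k) U.
    have [||||U] := @iid_row_coded R M g g_inj k.+1 (@A k).
    + exact: (rep_independent repA).
    + exact: (rep_trim repA).
    + by move=> i; rewrite (rep_outcomes repA) (range_code vs_bij oE).
    + have [sv _ svK] := vs_bij.
      by move=> i t; rewrite -(svK t) -oE (rep_uniform repA).
    + by exists U.
  have exV k : exists V : {ffun 'I_k.+1 -> _} -> 'I_(2 ^ (k.+1 * M.+1)),
      bijective V /\ cancel V (@column_code R M k.+1).
    have [V codeK VK] := @column_code_bij R M k.+1.
    by exists V; split=> //; exists (@column_code R M k.+1).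
  (* The permutations are read off from the codes of the rows of [A] by undoing
     [column_code]. *)
  pose U k := projT1 (cid (exU k)); have UE k := projT2 (cid (exU k)).
  pose V k := projT1 (cid (exV k)); have VE k := projT2 (cid (exV k)).
  have VU_inj k : injective (V k \o U k).
    exact: inj_comp (bij_inj (VE k).1) (bij_inj (UE k).1).
  pose p : perm_seq M := fun k => perm (@VU_inj k).
  have pA : perm_array g p = A.
    apply: functional_extensionality_dep => k.
    apply: functional_extensionality_dep => i; apply/mfuneqP => x.
    by rewrite (UE k).2 /= /cell_fun permE /= (VE k).2.
  exists p => //= k; apply/(admissibleP vs_bij oE) => x.
  by rewrite (rep_sum repA) -pA.
Qed.
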